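(* Let $\mathcal{H}$ be a real Hilbert space, let $C$ be a nonempty closed convex subset of $\mathcal{H}$, let $\phi\in\Gamma_0(\mathbb{R})$ be even, and set $\varphi=\phi\circ\|\cdot\|+\sigma_C$, $T_1=\operatorname{prox}_{\phi\circ\|\cdot\|}$, and $T_2=\operatorname{prox}_{\sigma_C}$. Then $T_1\circ T_2\in\mathcal{P}(\mathcal{H})$. More specifically, $T_1\circ T_2=\operatorname{prox}_\varphi$.
   Context: For a real Hilbert space $\mathcal{X}$, $\Gamma_0(\mathcal{X})$ is the class of lower semicontinuous convex functions $f\colon\mathcal{X}\to\left]-\infty,+\infty\right]$ with $\operatorname{dom}f=\{x\in\mathcal{X}\mid f(x)<+\infty\}\neq\varnothing$. For $f\in\Gamma_0(\mathcal{H})$, the proximity operator $\operatorname{prox}_f\colon\mathcal{H}\to\mathcal{H}$ maps $x$ to the unique minimizer over $y\in\mathcal{H}$ of $f(y)+\frac12\|x-y\|^2$; $\mathcal{P}(\mathcal{H})$ is the set of operators $T\colon\mathcal{H}\to\mathcal{H}$ such that $T=\operatorname{prox}_f$ for some $f\in\Gamma_0(\mathcal{H})$. $\sigma_C\colon u\mapsto\sup_{x\in C}\langle x\mid u\rangle$ is the support function of $C$. *)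

(* Defs.v *)
From HB Require Import structures.
From mathcomp Require Import all_boot all_order all_algebra.
From mathcomp Require Import all_classical all_reals all_analysis.

Set Implicit Arguments.
Unset Strict Implicit.
Unset Printing Implicit Defensive.

Import Order.TTheory GRing.Theory Num.Theory.
Import numFieldNormedType.Exports.

Local Open Scope classical_set_scope.
Local Open Scope ring_scope.

(* Positive definiteness is part of the last axiom, by which the norm (hence the
   topology and the completeness) of H is the one induced by the inner
   product. *)
HB.mixin Record NormedModule_hasInner (R : realType) H
    & NormedModule R H := {
  inner : H -> H -> R ;
  innerC : forall x y, inner x y = inner y x ;
  innerDl : forall x y z, inner (x + y) z = inner x z + inner y z ;
  innerZl : forall (a : R) x y, inner (a *: x) y = a * inner x y ;
  innerxx : forall x, inner x x = `|x| ^+ 2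
}.

#[short(type="hilbertType")]
HB.structure Definition Hilbert (R : realType) :=
  {H of CompleteNormedModule R H & NormedModule_hasInner R H}.

Section inner_dot.
Variables (R : realType) (H : hilbertType R).

Let inner_bilinear :
  bilinear_for (GRing.Scale.Law.clone _ _ *%R _)
    (GRing.Scale.Law.clone _ _ (@idfun R \; *%R) _) (@inner R H).
Proof.
split=> u a x y /=; first by rewrite innerDl innerZl.
by rewrite innerC innerDl innerZl !(innerC u).
Qed.

HB.instance Definition _ :=
  bilinear_isBilinear.Build R H H R _ _ (@inner R H) inner_bilinear.

Let inner_sym (x y : H) : inner x y = (-1) ^+ false * idfun (inner y x).
Proof. by rewrite mul1r innerC. Qed.

HB.instance Definition _ :=
  isHermitianSesquilinear.Build R H false (@idfun R) (@inner R H) inner_sym.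

Let inner_gt0 (x : H) : x != 0 -> 0 < inner x x.
Proof. by move=> x0; rewrite innerxx exprn_gt0 ?normr_gt0. Qed.

HB.instance Definition _ := isDotProduct.Build R H (@inner R H) inner_gt0.

End inner_dot.

Section real_line.
Variable R : realType.

Let inner_real (x y : R^o) : R := x * y.

Let inner_realC x y : inner_real x y = inner_real y x.
Proof. exact: mulrC. Qed.

Let inner_realDl x y z :
  inner_real (x + y) z = inner_real x z + inner_real y z.
Proof. exact: mulrDl. Qed.

Let inner_realZl (a : R) x y : inner_real (a *: x) y = a * inner_real x y.
Proof. by rewrite /inner_real mulrA. Qed.

Let inner_realxx x : inner_real x x = `|x| ^+ 2.
Proof. by rewrite /inner_real -expr2 real_normK ?num_real. Qed.

HB.instance Definition _ := NormedModule_hasInner.Build R R^o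
  inner_realC inner_realDl inner_realZl inner_realxx.

End real_line.

Section prox.
Context {R : realType} {H : hilbertType R}.
Implicit Types (f g : H -> \bar R) (T : H -> H) (C : set H).
Local Open Scope ereal_scope.

Definition ereal_convex f := forall (x y : H) (t : R), (0 < t < 1)%R ->
  f (t *: x + (1 - t) *: y)%R <= t%:E * f x + (1 - t)%:E * f y.

Definition Gamma0 f :=
  [/\ (forall x, -oo < f x), (exists x, f x < +oo),
      lower_semicontinuous f & ereal_convex f].

Definition minimizer g (p : H) := forall y, g p <= g y.

(* The default value 0 is only taken where there is no unique minimizer, which
   does not happen for f in Gamma0. *)
Definition prox f (x : H) : H :=
  xget 0%R [set p | unique
    (minimizer (fun y => f y + (2^-1 * `|x - y| ^+ 2)%:E)) p].

Definition prox_operator T := exists2 f, Gamma0 f & T = prox f.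

Definition support_function C (u : H) : \bar R :=
  ereal_sup [set (inner x u)%:E | x in C].

End prox.

(* Main.v *)
(* Let [p] be the projection of [x] onto [C], so that [p] maximizes
   [inner c z] over [c] in [C], where [z = x - p]. The linear form [inner p]
   minorizes the support function and coincides with it on the ray [R_+ z]. Up to a
   constant, adding [inner p] to a function [f] translates its proximal
   objective from [x] to [z]; hence a minimizer for [f] at [z] lying on that ray
   is a minimizer for [f + sigma_C] at [x]. With [f = 0] this gives
   [prox sigma_C x = z]; with [f = phi o norm], whose minimizer at [z] lies on
   the ray because [f] is radial and nondecreasing in the norm, it gives the
   composition formula. *)
Require Import Defs.
From mathcomp Require Import all_boot all_order all_algebra.
From mathcomp Require Import ring lra.
From mathcomp Require Import all_classical all_reals all_analysis.

Set Implicit Arguments.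
Unset Strict Implicit.
Unset Printing Implicit Defensive.

Import Order.TTheory GRing.Theory Num.Theory.
Import numFieldNormedType.Exports.

Local Open Scope classical_set_scope.
Local Open Scope ring_scope.

(** * Lower semicontinuity of extended-real functions *)

Section lower_semicontinuity.
Context {R : realType} {X : topologicalType}.
Implicit Types f g : X -> \bar R.
Local Open Scope ereal_scope.

Lemma lower_semicontinuousD f g :
  (forall x, -oo < f x) -> (forall x, -oo < g x) ->
  lower_semicontinuous f -> lower_semicontinuous g ->
  lower_semicontinuous (fun x => f x + g x).
Proof.
move=> fNy gNy flsc glsc x a afg.
(* If both values are finite, each bound gives up half of the gap; otherwise an infinite value
   absorbs the rest. *)
have [b bf [c cg abc]] : exists2 b : R, b%:E < f x &
    exists2 c : R, c%:E < g x & (a <= b + c)%R.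
  case: (f x) (g x) (fNy x) (gNy x) afg => [r||] [s||] //= _ _ afg.
  - rewrite -EFinD lte_fin in afg.
    exists (r - (r + s - a) / 2)%R; first by rewrite lte_fin; lra.
    by exists (s - (r + s - a) / 2)%R; [rewrite lte_fin; lra|lra].
  - exists (r - 1)%R; first by rewrite lte_fin; lra.
    by exists (a - (r - 1))%R; [rewrite ltry|lra].
  - exists (a - (s - 1))%R; first by rewrite ltry.
    by exists (s - 1)%R; [rewrite lte_fin; lra|lra].
  - by exists a; [rewrite ltry|exists 0%R; [rewrite ltry|lra]].
have [U xU Uf] := flsc _ _ bf; have [V xV Vg] := glsc _ _ cg.
exists (U `&` V); first exact: filterI.
move=> y [/Uf bfy /Vg cgy]; apply: (@le_lt_trans _ _ (b%:E + c%:E)).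
  by rewrite -EFinD lee_fin.
exact: lteD.
Qed.

Lemma continuous_lower_semicontinuous (h : X -> R) :
  continuous h -> lower_semicontinuous (fun x => (h x)%:E).
Proof.
move=> hc x a; rewrite lte_fin => ahx; exists [set y | (a < h y)%R] => //.
by apply: (cvgr_gt (h x)) => //; exact: hc.
Qed.

Lemma lower_semicontinuous_comp {Y : topologicalType} (h : Y -> X) f :
  continuous h -> lower_semicontinuous f ->
  lower_semicontinuous (fun y => f (h y)).
Proof.
move=> hc flsc y a /flsc[V hyV Vf].
by exists (h @^-1` V); [exact: hc|move=> z /Vf].
Qed.

(** The bound is shaped for minimizing sequences: with [m] the infimum, the limit attains it. *)
Lemma lower_semicontinuous_cvg_le f (u : X^nat) (m : R) (l : X) :
  lower_semicontinuous f -> u @ \oo --> l ->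
  (forall n, f (u n) <= (m + n.+1%:R^-1)%:E) -> f l <= m%:E.
Proof.
move=> flsc ul fu; rewrite leNgt; apply/negP => mfl.
have [a ma afl] : exists2 a : R, (m < a)%R & a%:E < f l.
  case: (f l) mfl => [r||]//; last by exists (m + 1)%R; [lra|rewrite ltry].
  by rewrite lte_fin => mr; exists ((m + r) / 2)%R; rewrite ?lte_fin; lra.
have [V lV Vf] := flsc _ _ afl.
have am : (0 < a - m)%R by lra.
near \oo => n.
have /Vf : V (u n) by near: n; exact: ul.
rewrite ltNge => /negP; apply; apply: (le_trans (fu n)); rewrite lee_fin.
rewrite -lerBrDl ltW//; near: n; exact: near_infty_natSinv_lt (PosNum am).
Unshelve. all: by end_near. Qed.

End lower_semicontinuity.

(** * Inner product identities *)

Section inner_theory.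
Context {R : realType} {H : hilbertType R}.
Implicit Types x y z : H.

Lemma innerDr x y z : inner x (y + z) = inner x y + inner x z.
Proof. exact: linearDr. Qed.

Lemma innerBr x y z : inner x (y - z) = inner x y - inner x z.
Proof. exact: linearBr. Qed.

Lemma innerZr (a : R) x y : inner x (a *: y) = a * inner x y.
Proof. exact: linearZr_LR. Qed.

Lemma innerBl x y z : inner (x - y) z = inner x z - inner y z.
Proof. exact: linearBl. Qed.

Lemma normB_inner x y :
  `|x - y| ^+ 2 = `|x| ^+ 2 - 2 * inner x y + `|y| ^+ 2.
Proof.
by rewrite -!innerxx !(innerBl, innerBr) (innerC y x); ring.
Qed.

(** The weights match [ereal_convex] at [t = 2^-1]; the negative term is the source of strong
    convexity. *)
Lemma parallelogram_midpoint x a b :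
  `|x - (2^-1 *: a + (1 - 2^-1) *: b)| ^+ 2 =
  2^-1 * `|x - a| ^+ 2 + 2^-1 * `|x - b| ^+ 2 - 4^-1 * `|a - b| ^+ 2.
Proof.
rewrite !normB_inner -(innerxx (_ + _)) !(innerDl, innerDr).
by rewrite !(innerZl, innerZr) -!innerxx (innerC b a); field.
Qed.

Lemma continuous_inner x : continuous (inner x).
Proof.
(* Polarization reduces the claim to continuity of the norm. *)
have -> : inner x = fun y : H =>
    2^-1 * (`|x| ^+ 2 + `|y| ^+ 2 - `|x - y| ^+ 2).
  by apply/funext => y; rewrite normB_inner; field.
move=> y; apply: cvgM; first exact: cvg_cst.
apply: cvgB.
  apply: cvgD; first exact: cvg_cst.
  by apply: cvgM; apply: cvg_norm.
by apply: cvgM; apply: cvg_norm; apply: cvgB => //; exact: cvg_cst.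
Qed.

End inner_theory.

(** * Uniqueness and existence of proximal points *)

Section prox_theory.
Context {R : realType} {H : hilbertType R}.
Implicit Types (f : H -> \bar R) (x p : H).
Local Open Scope ereal_scope.

Definition prox_objective f x : H -> \bar R :=
  fun y => f y + (2^-1 * `|x - y| ^+ 2)%:E.

(* Strong convexity of the objective, at the midpoint of [a] and [b]. *)
Lemma prox_objective_dist f x a b (A B m : R) :
  (forall y, -oo < f y) -> ereal_convex f ->
  prox_objective f x a <= A%:E -> prox_objective f x b <= B%:E ->
  (forall y, m%:E <= prox_objective f x y) ->
  (`|a - b| ^+ 2 <= 4 * (A + B - 2 * m))%R.
Proof.
move=> fNy fconv; rewrite /prox_objective => fA fB.
have half01 : (0 < (2^-1 : R) < 1)%R by apply/andP; split; lra.
move/(_ (2^-1 *: a + (1 - 2^-1) *: b)%R); rewrite parallelogram_midpoint.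
move: (fconv a b 2^-1%R half01) (fNy (2^-1 *: a + (1 - 2^-1) *: b)%R).
case: (f a) (fNy a) fA => [r||]//= _; rewrite -EFinD lee_fin => fA.
case: (f b) (fNy b) fB => [s||]//= _; rewrite -EFinD lee_fin => fB.
case: (f _) => [t||]//=; rewrite -!EFinM -!EFinD !lee_fin => ? _ ?.
lra.
Qed.

Lemma prox_objective_fin f x : Gamma0 f ->
  exists y, prox_objective f x y < +oo.
Proof.
by case=> _ [y fy] _ _; exists y; rewrite lte_add_pinfty// ltry.
Qed.

(** Two minimizers share a finite value [m], so [prox_objective_dist] with [A = B = m] makes their
    distance vanish. *)
Lemma minimizer_prox_objective_unique f x p : Gamma0 f ->
  minimizer (prox_objective f x) p ->
  unique (minimizer (prox_objective f x)) p.
Proof.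
move=> Gf pmin; split=> // q qmin; have [y gy] := prox_objective_fin x Gf.
have [fNy _ _ fconv] := Gf.
have gp : prox_objective f x p \is a fin_num.
  rewrite fin_real// (le_lt_trans (pmin y) gy) andbT.
  by rewrite /prox_objective; case: (f p) (fNy p) => [r||]//= _; rewrite ltNyr.
have pE := fineK gp; set m := fine _ in pE.
have /(prox_objective_dist fNy fconv) : prox_objective f x p <= m%:E.
  by rewrite pE.
move=> /(_ q m m); rewrite pE => /(_ (qmin p) pmin) pq.
have : (`|p - q| ^+ 2 <= 0)%R by lra.
by rewrite exprn_even_le0//= normr_eq0 subr_eq0 => /eqP.
Qed.

Lemma prox_eq f x p : Gamma0 f ->
  minimizer (prox_objective f x) p -> prox f x = p.
Proof.
move=> Gf /(minimizer_prox_objective_unique Gf) pP.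
apply: xget_unique => [|q [qmin _]]; first exact: pP.
by rewrite (pP.2 q).
Qed.

Lemma lower_semicontinuous_prox_objective f x : (forall y, -oo < f y) ->
  lower_semicontinuous f -> lower_semicontinuous (prox_objective f x).
Proof.
move=> fNy flsc.
apply: (lower_semicontinuousD fNy _ flsc) => [y|]; first by rewrite ltNyr.
apply: continuous_lower_semicontinuous => y; apply: cvgM; first exact: cvg_cst.
by apply: cvgM; apply: cvg_norm; apply: cvgB => //; exact: cvg_cst.
Qed.

(* A minimizing sequence of the objective is Cauchy by strong convexity. *)
Lemma prox_minimizer f x (c : R) : Gamma0 f -> (forall y, c%:E <= f y) ->
  minimizer (prox_objective f x) (prox f x).
Proof.
move=> Gf cf; have [fNy _ flsc fconv] := Gf.
suff [p pmin] : exists p, minimizer (prox_objective f x) p.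
  by rewrite (prox_eq Gf pmin).
have [y0 gy0] := prox_objective_fin x Gf.
set g := prox_objective f x in gy0 *.
have cg y : c%:E <= g y.
  by rewrite -[leLHS]adde0 leeD// lee_fin mulr_ge0// exprn_ge0.
have infg : ereal_inf (range g) \is a fin_num.
  rewrite fin_real// (lt_le_trans (ltNyr c)) /=; last first.
    by apply: le_ereal_inf_tmp => _ [y _ <-].
  by rewrite (le_lt_trans _ gy0)//; apply: ereal_inf_lbound; exists y0.
have infE := fineK infg; set m := fine _ in infE.
have mg y : m%:E <= g y by rewrite infE; apply: ereal_inf_lbound; exists y.
have approx n : exists y, g y <= (m + n.+1%:R^-1)%:E.
  have n0 : (0 < n.+1%:R^-1 :> R)%R by rewrite invr_gt0.
  have [_ [y _ <-] gy] := lb_ereal_inf_adherent n0 infg.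
  by exists y; rewrite EFinD infE ltW.
have [u ug] := choice approx.
have ucvg : cvg (u @ \oo).
  apply/cauchy_cvgP/cauchy_ballP => /= e' e'0.
  have [e e0 ->] : exists2 e : R, (0 < e)%R & e' = e by exists e'.
  (* Two excesses over [m] below [e ^+ 2 / 8] give a squared distance below
     [4 * (e ^+ 2 / 8 + e ^+ 2 / 8) = e ^+ 2]. *)
  have e8 : (0 < e ^+ 2 / 8)%R by rewrite divr_gt0// exprn_gt0.
  have [N _ Ne] := near_infty_natSinv_lt (PosNum e8).
  pose V := [set u n | n in [set n | (N <= n)%N]].
  have uV : (u @ \oo) V by exists N => // n Nn; exists n.
  exists (V, V) => // -[_ _] /= [[i iN <-] [j jN <-]].
  have ie : (i.+1%:R^-1 < e ^+ 2 / 8)%R := Ne i iN.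
  have je : (j.+1%:R^-1 < e ^+ 2 / 8)%R := Ne j jN.
  have uij := prox_objective_dist fNy fconv (ug i) (ug j) mg.
  rewrite -ball_normE /=.
  rewrite -(ltr_pXn2r (ltn0Sn 1)) ?nnegrE ?(ltW e0)//.
  by move: (i.+1%:R^-1)%R (j.+1%:R^-1)%R ie je uij => ri rj; lra.
exists (lim (u @ \oo)) => y; apply: le_trans (mg y).
apply: lower_semicontinuous_cvg_le ucvg ug.
exact: lower_semicontinuous_prox_objective.
Qed.

End prox_theory.

(** * Sums, indicators and projections *)

Section Gamma0_theory.
Context {R : realType} {H : hilbertType R}.
Implicit Types (f g : H -> \bar R) (C : set H).
Local Open Scope ereal_scope.

Lemma Gamma0D f g : Gamma0 f -> Gamma0 g ->
  (exists x, f x < +oo /\ g x < +oo) -> Gamma0 (fun x => f x + g x).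
Proof.
case=> [fNy _ flsc fconv] [gNy _ glsc gconv] [x [fx gx]]; split.
- by move=> y; case: (f y) (g y) (fNy y) (gNy y) => [r||] [s||]//= _ _;
    rewrite ltNyr.
- by exists x; exact: lte_add_pinfty.
- exact: lower_semicontinuousD.
- move=> y z t t01; rewrite !muleDr ?ltninfty_adde_def ?inE//.
  by rewrite addeACA; apply: leeD; [exact: fconv|exact: gconv].
Qed.

Lemma convex_set_combination C x y (t : R) : convex_set C ->
  C x -> C y -> (0 < t < 1)%R -> C (t *: x + (1 - t) *: y)%R.
Proof.
move=> cC Cx Cy /andP[t0 t1].
have := cC x y (Itv01 (ltW t0) (ltW t1)).
by rewrite !inE => /(_ Cx Cy).
Qed.

(** Its proximal points are the projections onto [C], so [prox_minimizer] yields their existence. *)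
Definition convex_indicator C : H -> \bar R :=
  fun x => if x \in C then 0 else +oo.

Lemma convex_indicator_ge0 C x : 0 <= convex_indicator C x.
Proof. by rewrite /convex_indicator; case: ifP. Qed.

Lemma Gamma0_convex_indicator C : C !=set0 -> closed C -> convex_set C ->
  Gamma0 (convex_indicator C).
Proof.
move=> [c Cc] clC cC; split.
- by move=> x; apply: lt_le_trans (convex_indicator_ge0 C x); rewrite ltNyr.
- by exists c; rewrite /convex_indicator mem_set// ltry.
- move=> x a; rewrite /convex_indicator; case: ifPn => [_ a0|xC _].
    exists setT; first exact: filterT.
    by move=> y _; apply: lt_le_trans a0 (convex_indicator_ge0 C y).
  exists (~` C).
    apply: open_nbhs_nbhs; split; first exact: closed_openC.
    by move=> /mem_set; apply/negP.
  by move=> y Cy; rewrite memNset// ltry.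
- move=> x y t t01; have /andP[t0 t1] := t01.
  rewrite {2 3}/convex_indicator.
  have u0 : (0 < 1 - t)%R by lra.
  case: ifPn => [xC|_]; case: ifPn => [yC|_].
  + rewrite /convex_indicator mem_set ?mule0 ?adde0//.
    by apply: convex_set_combination => //; exact: set_mem.
  + by rewrite gt0_muley ?lte_fin// mule0 add0e leey.
  + by rewrite gt0_muley ?lte_fin// mule0 adde0 leey.
  + by rewrite !gt0_muley ?lte_fin// leey.
Qed.

Lemma projection_exists C x : C !=set0 -> closed C -> convex_set C ->
  exists2 p, C p & forall c, C c -> (inner c (x - p) <= inner p (x - p))%R.
Proof.
move=> C0 clC cC; have GC := Gamma0_convex_indicator C0 clC cC.
have := prox_minimizer x GC (convex_indicator_ge0 C); set p := prox _ _ => pmin.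
have objC y : C y ->
    prox_objective (convex_indicator C) x y = (2^-1 * `|x - y| ^+ 2)%:E.
  by move=> Cy; rewrite /prox_objective /convex_indicator mem_set// add0e.
have Cp : C p.
  have [c Cc] := C0; apply: set_mem; move: (pmin c); rewrite (objC _ Cc).
  by rewrite /prox_objective /convex_indicator; case: ifPn; rewrite // leye_eq.
exists p => // c Cc; rewrite -subr_ge0 -opprB -innerBl oppr_ge0 leNgt.
apply/negP; set k := inner _ _ => k0.
have N0 : (0 <= `|c - p| ^+ 2)%R by rewrite exprn_ge0.
have kN : (0 < k + `|c - p| ^+ 2 + 1)%R by lra.
(* Moving from [p] towards [c] by [t] changes half the squared distance to [x] by
   [- t * k + t ^+ 2 * |c - p| ^+ 2 / 2]. This [t] satisfies [t * |c - p| ^+ 2 < k], so the change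
   is negative; the [+ 1] ensures [t < 1]. *)
pose t := (k / (k + `|c - p| ^+ 2 + 1))%R.
have tE : (t * (k + `|c - p| ^+ 2 + 1) = k)%R by rewrite divfK// gt_eqF.
have t0 : (0 < t)%R by rewrite divr_gt0.
have t1 : (t < 1)%R by rewrite ltr_pdivrMr//; lra.
have Cy := convex_set_combination cC Cc Cp (introT andP (conj t0 t1)).
have := pmin (t *: c + (1 - t) *: p)%R; rewrite !objC// lee_fin.
have -> : (x - (t *: c + (1 - t) *: p) = (x - p) - t *: (c - p))%R.
  by rewrite scalerBl scale1r addrCA -scalerBr opprD addrA.
rewrite [in X in (_ <= X)%R]normB_inner innerZr (innerC (x - p)%R) -/k normrZ.
rewrite exprMn real_normK ?num_real//; nra.
Qed.

End Gamma0_theory.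

(** * Support functions *)

Section support_function_theory.
Context {R : realType} {H : hilbertType R}.
Variable C : set H.
Hypothesis C_neq0 : C !=set0.
Local Open Scope ereal_scope.

Lemma le_support_function c u : C c -> (inner c u)%:E <= support_function C u.
Proof. by move=> Cc; apply: ereal_sup_ubound; exists c. Qed.

(** The point [p] maximizes [inner c z] over [C], and a nonnegative scaling of [z] keeps it a
    maximizer. *)
Lemma support_functionZ_eq p z (l : R) : C p ->
  (forall c, C c -> (inner c z <= inner p z)%R) -> (0 <= l)%R ->
  support_function C (l *: z)%R = (inner p (l *: z)%R)%:E.
Proof.
move=> Cp pz l0; apply/eqP; rewrite eq_le le_support_function// andbT.
apply: ge_ereal_sup => _ [c Cc <-]; rewrite lee_fin !innerZr.
by rewrite ler_wpM2l// pz.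
Qed.

Lemma support_function0 : support_function C 0%R = 0.
Proof.
have [c Cc] := C_neq0.
have inner0 d : inner d (0 : H)%R = 0%R by exact: linear0r.
have := le_support_function 0%R Cc; rewrite inner0 => s0.
apply/eqP; rewrite eq_le s0 andbT.
by apply: ge_ereal_sup => _ [d _ <-]; rewrite inner0.
Qed.

(** A supremum of continuous linear forms inherits lower semicontinuity and convexity. *)
Lemma Gamma0_support_function : Gamma0 (support_function C).
Proof.
have [c Cc] := C_neq0; split.
- by move=> x; apply: lt_le_trans (le_support_function x Cc); rewrite ltNyr.
- by exists 0%R; rewrite support_function0 ltry.
- move=> x a /ereal_sup_gt[_ [d Cd <-]]; rewrite lte_fin => adx.
  exists [set y | (a < inner d y)%R].
    by apply: (cvgr_gt (inner d x)) => //; exact: continuous_inner.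
  by move=> y ady; apply: lt_le_trans (le_support_function y Cd).
- move=> x y t /andP[t0 t1]; apply: ge_ereal_sup => _ [d Cd <-].
  rewrite innerDr !innerZr EFinD !EFinM.
  by apply: leeD; apply: lee_wpmul2l;
    rewrite ?le_support_function// lee_fin ?subr_ge0 ltW.
Qed.

End support_function_theory.

(** * Even convex functions of the norm *)

Section even_radial.
Context {R : realType} {H : hilbertType R}.
Variable phi : R^o -> \bar R.
Hypothesis phi_Gamma0 : Gamma0 phi.
Hypothesis phi_even : forall x : R^o, phi (- x) = phi x.
Local Open Scope ereal_scope.

(** Since [a] lies between [- b] and [b], where [phi] takes the same value, convexity bounds [phi a]
    by that value. *)
Lemma even_convex_nondecreasing (a b : R) :
  (0 <= a)%R -> (a <= b)%R -> phi a <= phi b.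
Proof.
move=> a0; rewrite le_eqVlt => /predU1P[->//|ab].
have [phiNy _ _ phi_conv] := phi_Gamma0.
have b0 : (0 < b)%R by lra.
(* The weight solving [a = t * b + (1 - t) * (- b)]. *)
pose t : R := ((a + b) / (2 * b))%R.
have tE : (t * (2 * b) = a + b)%R by rewrite divfK// mulf_neq0// gt_eqF.
have t0 : (0 < t)%R by rewrite divr_gt0//; lra.
have t1 : (t < 1)%R by rewrite ltr_pdivrMr; lra.
have := phi_conv b (- b)%R t (introT andP (conj t0 t1)); rewrite phi_even.
have -> : (t *: b + (1 - t) *: (- b) = a :> R)%R by rewrite /GRing.scale/=; lra.
case: (phi b) (phiNy b) => [r||]// _; last by rewrite leey.
by rewrite -!EFinM -EFinD -mulrDl [(t + _)%R]addrC subrK mul1r.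
Qed.

Lemma even_normr (y : R) : phi `|y|%R = phi y.
Proof. by case: (ger0P y) => // _; exact: phi_even. Qed.

(** Monotonicity makes 0 a minimizer of [phi]; it also gives a point where [phi] of the norm and the
    support function are both finite. *)
Lemma even_convex_finite0 : phi 0%R < +oo.
Proof.
have [_ [r phir] _ _] := phi_Gamma0; apply: le_lt_trans phir.
by rewrite -(even_normr r); apply: even_convex_nondecreasing.
Qed.

(** Convexity combines the triangle inequality with monotonicity of [phi] on nonnegative reals. *)
Lemma Gamma0_radial : Gamma0 (fun x : H => phi `|x|%R).
Proof.
have [phiNy _ phi_lsc phi_conv] := phi_Gamma0; split.
- by move=> x.
- by exists 0%R; rewrite normr0; exact: even_convex_finite0.
- apply: (lower_semicontinuous_comp (h := fun x : H => `|x|%R : R^o)) phi_lsc.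
  exact: norm_continuous.
- move=> x y t t01; apply: le_trans (phi_conv _ _ _ t01).
  have /andP[t0 t1] := t01.
  apply: even_convex_nondecreasing => //; apply: le_trans (ler_normD _ _) _.
  by rewrite !normrZ gtr0_norm// gtr0_norm// subr_gt0.
Qed.

Lemma radial_prox_minimizer (z : H) :
  minimizer (prox_objective (fun x : H => phi `|x|%R) z)
    (prox (fun x : H => phi `|x|%R) z).
Proof.
have phi0 : phi 0%R \is a fin_num.
  by rewrite fin_real// even_convex_finite0 andbT; case: phi_Gamma0.
apply: (@prox_minimizer _ _ _ _ (fine (phi 0%R)) Gamma0_radial) => y.
by rewrite fineK// even_convex_nondecreasing.
Qed.

(* Rotating the minimizer onto the ray through [z] keeps its norm and does not
   increase its distance to [z]. *)
Lemma prox_radial (z : H) :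
  exists2 l : R, (0 <= l)%R & prox (fun x : H => phi `|x|%R) z = (l *: z)%R.
Proof.
have := radial_prox_minimizer z; set q := prox _ _ => qmin.
(* If [z = 0], the candidate [l *: z] is 0 whatever [l] is; this case is treated apart below. *)
pose l := (`|q| / `|z|)%R; exists l; first by rewrite divr_ge0.
apply: (prox_eq Gamma0_radial) => y; apply: le_trans (qmin y).
have lz : (`|l *: z| <= `|q| /\ `|z - l *: z| <= `|z - q|)%R.
  have [->|z0] := eqVneq z 0%R; first by rewrite scaler0 normr0 subr0 normr0.
  have lzE : (l * `|z| = `|q|)%R by rewrite divfK// normr_eq0.
  rewrite normrZ ger0_norm ?divr_ge0// lzE; split=> //.
  (* The norm of [z - l *: z] is the absolute difference of the norms of [z] and [q], so the reverse
     triangle inequality concludes. *)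
  have -> : (z - l *: z = (1 - l) *: z)%R by rewrite scalerBl scale1r.
  rewrite normrZ -[X in (_ * X)%R]normr_id -normrM mulrBl mul1r lzE.
  exact: ler_dist_dist.
apply: leeD; first by case: lz => lz _; apply: even_convex_nondecreasing.
by rewrite lee_fin ler_pM2l// ler_pXn2r ?nnegrE//; case: lz.
Qed.

End even_radial.

(** * Proximal points of a sum *)

Section prox_sum.
Context {R : realType} {H : hilbertType R}.
Implicit Types (f s : H -> \bar R).
Local Open Scope ereal_scope.

(* Replacing [s] by its affine minorant [inner p], which is exact at [q], turns
   the objective of [f + s] at [x] into that of [f] at [x - p], up to a
   constant. *)
Lemma minimizer_prox_objectiveD f s (x p q : H) :
  (forall y, (inner p y)%:E <= s y) -> s q = (inner p q)%:E ->
  minimizer (prox_objective f (x - p)%R) q ->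
  minimizer (prox_objective (fun y => f y + s y) x) q.
Proof.
move=> ps sq qmin y.
(* Completing the square in [u] absorbs the linear form. *)
have shift u : f u + (inner p u)%:E + (2^-1 * `|x - u| ^+ 2)%:E =
    prox_objective f (x - p)%R u + (inner p x - 2^-1 * `|p| ^+ 2)%:E.
  rewrite /prox_objective -!addeA -!EFinD; congr (_ + _%:E).
  rewrite addrAC (normB_inner (x - u)%R p) innerBl.
  by rewrite (innerC x) (innerC u); field.
rewrite {1}/prox_objective sq shift.
apply: le_trans (leeD2r _ (qmin y)) _; rewrite -shift.
by apply: leeD2r; exact: leeD2l.
Qed.

End prox_sum.

Theorem proposition3p14 (R : realType) (H : hilbertType R)
    (C : set H) (C_neq0 : C !=set0) (C_closed : closed C)
    (C_convex : convex_set C)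
    (phi : R^o -> \bar R) (phi_Gamma0 : Gamma0 phi)
    (phi_even : forall x : R^o, phi (- x) = phi x) :
  let phi_norm := fun x : H => phi `|x| in
  let varphi := fun x : H => (phi_norm x + support_function C x)%E in
  let T1 : H -> H := prox phi_norm in
  let T2 : H -> H := prox (support_function C) in
  prox_operator (T1 \o T2) /\ (Gamma0 varphi /\ T1 \o T2 = prox varphi).
Proof.
move=> phi_norm varphi T1 T2.
have Gs := Gamma0_support_function C_neq0.
have Gphi : Gamma0 phi_norm by exact: Gamma0_radial.
have Gvarphi : Gamma0 varphi.
  apply: Gamma0D => //; exists 0; rewrite support_function0// ltry.
  by rewrite /phi_norm normr0 (even_convex_finite0 phi_Gamma0).
suff TE : T1 \o T2 = prox varphi by split; [exists varphi|].
apply/funext => x /=; apply/esym/(prox_eq Gvarphi).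
have [p Cp pmax] := projection_exists x C_neq0 C_closed C_convex.
have ps y : ((inner p y)%:E <= support_function C y)%E.
  exact: le_support_function.
have -> : T2 x = x - p.
  apply: (prox_eq Gs).
  (* With zero as first summand, the translated objective is half the squared distance to [x - p],
     minimal at [x - p] itself. *)
  have -> : support_function C = fun y => (0 + support_function C y)%E.
    by apply/funext => y; rewrite add0e.
  apply: (minimizer_prox_objectiveD (p := p)) => //.
    by rewrite -[x - p]scale1r (support_functionZ_eq Cp).
  move=> y; rewrite /prox_objective !add0e subrr normr0 expr0n mulr0 lee_fin.
  by rewrite mulr_ge0// exprn_ge0.
have [l l0 qE] := prox_radial phi_Gamma0 phi_even (x - p).
apply: (minimizer_prox_objectiveD (p := p)) => //.
  by rewrite /T1 qE (support_functionZ_eq Cp).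
exact: radial_prox_minimizer.
Qed.
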